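(* Every second-countable submetrizable topological space $X$ of cardinality $|X|<\mathfrak q_0$ is symmetrizable.
   Context: A symmetric on a set $X$ is a function $d:X\times X\to[0,\infty)$ such that for all $x,y\in X$: (1) $d(x,y)=0$ if and only if $x=y$; (2) $d(x,y)=d(y,x)$. (No triangle inequality is required.) For $x\in X$ and $\varepsilon>0$ put $B_d(x;\varepsilon)=\{y\in X:d(x,y)<\varepsilon\}$. The topology of a topological space $X$ is generated by $d$ if a subset $U\subseteq X$ is open if and only if for every $x\in U$ there exists $\varepsilon>0$ such that $B_d(x;\varepsilon)\subseteq U$. A topological space is symmetrizable if its topology is generated by some symmetric. A topological space $X$ is submetrizable if it admits a continuous metric, i.e. a metric $\rho:X\times X\to[0,\infty)$ that is continuous with respect to the topology of $X$ (the topology of $X$ need not be generated by $\rho$). A topological space $X$ is a $Q$-space if every subset of $X$ is of type $G_\delta$ in $X$ (an intersection of countably many open sets). The cardinal $\mathfrak q_0$ is the smallest cardinality of a second-countable metrizable space which is not a $Q$-space. *)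

(* Defs.v *)
From mathcomp Require Import all_boot all_order all_algebra.
From mathcomp Require Import all_classical all_reals all_analysis borel_hierarchy.

Set Implicit Arguments.
Unset Strict Implicit.
Unset Printing Implicit Defensive.

Import Order.TTheory GRing.Theory Num.Theory.
Import numFieldNormedType.Exports.

Local Open Scope classical_set_scope.
Local Open Scope card_scope.
Local Open Scope ring_scope.

Definition is_symmetric (R : realType) (X : Type) (d : X -> X -> R) : Prop :=
  [/\ forall x y, 0 <= d x y,
      forall x y, d x y = 0 <-> x = y
    & forall x y, d x y = d y x].

Definition is_metric (R : realType) (X : Type) (d : X -> X -> R) : Prop :=
  is_symmetric d /\ forall x y z, d x z <= d x y + d y z.

(* The library's [ball] belongs to the pseudometric structure carried by a
   type; here the distance is an arbitrary function. *)
Definition dball (R : realType) (X : Type) (d : X -> X -> R) (x : X) (e : R)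
  : set X := [set y | d x y < e].

Definition generates_topology (R : realType) (X : topologicalType)
    (d : X -> X -> R) : Prop :=
  forall U : set X,
    open U <-> forall x, U x -> exists2 e : R, 0 < e & dball d x e `<=` U.

Definition symmetrizable (R : realType) (X : topologicalType) : Prop :=
  exists2 d : X -> X -> R, is_symmetric d & generates_topology d.

Definition metrizable (R : realType) (X : topologicalType) : Prop :=
  exists2 d : X -> X -> R, is_metric d & generates_topology d.

Definition submetrizable (R : realType) (X : topologicalType) : Prop :=
  exists2 rho : X -> X -> R,
    is_metric rho & continuous (fun p : X * X => rho p.1 p.2).

Definition Q_space (X : topologicalType) : Prop := forall A : set X, Gdelta A.

Definition sc_metrizable_not_Q (R : realType) (Y : topologicalType) : Prop :=
  [/\ @second_countable Y, metrizable R Y & ~ Q_space Y].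

(* The library has no type of cardinal numbers: a cardinal is given by a type
   of that cardinality, so [is_q0 R K] reads |K| = q_0 and determines K up to
   bijection. *)
Definition is_q0 (R : realType) (K : Type) : Prop :=
  (exists2 Y : topologicalType,
     sc_metrizable_not_Q R Y & [set: Y] #= [set: K]) /\
  (forall Y : topologicalType,
     sc_metrizable_not_Q R Y -> [set: K] #<= [set: Y]).

Definition card_lt (T U : Type) (A : set T) (B : set U) : Prop :=
  A #<= B /\ ~ (A #= B).

Lemma card_leTI (T U : Type) (f : T -> U) : injective f -> [set: T] #<= [set: U].
Proof.
move=> fi.
have h : set_inj [set: T] f by move=> x y _ _; exact: fi.
have /card_eqPle[_ e] := inj_card_eq h.
exact: card_le_trans e (card_leT _).
Qed.

(* Zorn's lemma on the sets of points of the product of the [Y i] on which every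
   projection is injective: one of the projections of a maximal set is onto. *)
Lemma min_card (I : Type) (i0 : I) (Y : I -> Type) :
  exists i, forall j, [set: Y i] #<= [set: Y j].
Proof.
pose P (Z : set (forall i, Y i)) :=
  forall i (z z' : forall i, Y i), Z z -> Z z' -> z i = z' i -> z = z'.
have [|Z [PZ maxZ]] := @Zorn_bigcup _ P.
  move=> F FP tot i z z' [A FA Az] [B FB Bz'].
  have [AB|BA] := tot _ _ FA FB.
  - exact: (FP _ FB i z z' (AB _ Az) Bz').
  - exact: (FP _ FA i z z' Az (BA _ Bz')).
have [i si] : exists i, forall y : Y i, exists2 z, Z z & z i = y.
  apply: contrapT => nex.
  have h j : exists y : Y j, forall z, Z z -> z j <> y.
    apply: contrapT => nj; apply: nex; exists j => y.
    apply: contrapT => ny; apply: nj; exists y => z Zz zy.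
    by apply: ny; exists z.
  have [w ww] : {w : forall j, Y j & forall j z, Z z -> z j <> w j}.
    exists (fun j => projT1 (cid (h j))) => j; exact: (projT2 (cid (h j))).
  apply: (maxZ (Z `|` [set w])).
    split; first by move=> z; left.
    move=> s; have Zw : Z w by apply: s; right.
    exact: (ww i0 w Zw).
  move=> j z z' [Zz|->] [Zz'|->] //.
  - exact: PZ.
  - by move=> e; case: (ww j z Zz e).
  - by move=> e; case: (ww j z' Zz' (esym e)).
exists i => j.
pose g y := projT1 (cid2 (si y)).
have gZ y : Z (g y) by rewrite /g; case: cid2.
have gi y : g y i = y by rewrite /g; case: cid2.
apply: (@card_leTI _ _ (fun y => g y j)) => y y' e.
by rewrite -(gi y) -(gi y') (PZ j _ _ (gZ y) (gZ y') e).
Qed.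

Lemma line_not_Q (R : realType) : sc_metrizable_not_Q R R.
Proof.
split.
- pose f (p : rat * rat) : set R := (ball (ratr p.1 : R) (ratr p.2))%classic.
  exists (range f).
    apply: card_le_trans (card_image_le _ _) _; exact: countableP.
  split.
    by move=> _ [p _ <-]; exact: ball_open.
  move=> x A; rewrite nbhsE => -[U [oU Ux] UA].
  have [c [r [xB BU]]] := open_subball_rat oU (mem_set Ux).
  exists (f (c, r)); last exact: subset_trans UA.
  by split; [exists (c, r) | exact: set_mem].
- exists (fun x y => `|x - y|).
    split; [split|].
    + by [].
    + by move=> x y; split=> [/normr0_eq0/eqP|->]; rewrite ?subrr ?normr0// subr_eq0 => /eqP.
    + by move=> x y; rewrite distrC.
    + by move=> x y z; exact: ler_distD.
  move=> U; rewrite openE; split=> h x Ux.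
    by have /nbhs_ballP[e e0 s] := h _ Ux; exists e.
  by have [e e0 s] := h _ Ux; apply/nbhs_ballP; exists e.
- by move/(_ (@rational R)); exact: not_rational_Gdelta.
Qed.


(* [is_q0] is satisfiable, i.e. the smallest cardinality exists. *)
Lemma q0_exists (R : realType) : exists K : Type, is_q0 R K.
Proof.
pose C (S : set R) := exists2 Y : topologicalType,
  sc_metrizable_not_Q R Y & [set: Y] #= S.
have CR : C setT by exists (R : topologicalType) => //; exact: line_not_Q.
have [[S hS] mS] := @min_card {S : set R | C S} (exist _ _ CR)
  (fun S => {x | sval S x}).
have mS' (S' : set R) : C S' -> S #<= S'.
  move=> CS'; have := mS (exist _ S' CS') => /=.
  have e (W : set R) : [set: {x | W x}] #= W.
    have i : set_inj [set: {x | W x}] (@proj1_sig R W) by move=> [x p] [y q] _ _ /=; exact: eq_exist.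
    have := inj_card_eq i.
    have -> : [set proj1_sig x | x in [set: {x | W x}]] = W.
      by apply/seteqP; split=> [_ [[x p] _ <-]//|x p]; exists (exist _ x p).
    exact: card_esym.
  by rewrite (card_le_eql (e _)) (card_le_eqr (e _)).
have [Y hY YS] := hS.
exists Y; split; first by exists Y.
move=> Z hZ; rewrite (card_le_eql YS).
have : [set: Z] #<= [set: R] \/ [set: R] #<= [set: Z].
  have [[] m] := @min_card bool true (fun b => if b then R : Type else Z : Type).
    by right; exact: (m false).
  by left; exact: (m true).
case=> [ZR|RZ]; last exact: card_le_trans (card_leT _) RZ.
have [f] := pcard_leTP ZR.
have fe := inj_card_eq (@inj _ _ _ f).
rewrite -(card_le_eqr fe); apply: mS'; exists Z => //.
exact: card_esym.
Qed.

(* Main.v *)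
Require Import Defs.
From mathcomp Require Import all_boot all_order all_algebra.
From mathcomp Require Import all_classical all_reals all_analysis.
From HB Require Import structures.

(** The proof splits into a cardinality argument, which shows that [X] is
    itself a Q-space, and a direct construction of a symmetric on any
    second-countable T1 Q-space.

    Let [rho] be a continuous metric on [X]. The metric topology of [rho] is
    coarser than that of [X], so it is separable because [X] is, hence
    second-countable ([dist_space_second_countable]). The metric space
    [(X, rho)] has fewer than q_0 points, so it is a Q-space
    ([lt_q0_Q_space]); as its open sets are open in [X], so is [X]
    ([dist_space_Q_space]). Moreover [X] is T1, since the balls of [rho] are
    open in [X].

    In a Q-space every member of a countable base is a countable union of
    closed sets. This yields a sequence of pairs [F n `<=` U n] with [F n]
    closed and [U n] open such that every point of an open set [V] lies in
    some [F n] with [U n `<=` V]. Say that stage [n] separates two points if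
    one of them lies in [F n] and the other outside [U n], and let [d x y] be
    the inverse of one plus the first stage that separates [x] from [y], or 0
    if there is none. This is symmetric by construction. The balls of [d] are
    open, because for fixed [x] the points that stage [n] does not separate
    from [x] form an open set; and they are small, because a point close
    enough to [x] that stage [n] does not separate it from [x] lies in [U n]
    as soon as [x] lies in [F n] ([symmetrizable_shrinking]). *)

Local Open Scope classical_set_scope.

Set Implicit Arguments.
Unset Strict Implicit.
Unset Printing Implicit Defensive.

Import Order.TTheory GRing.Theory Num.Theory.
Import numFieldNormedType.Exports.

(** * A symmetric from a countable family of separations *)

Section InvFirst.
Local Open Scope ring_scope.
Variables (R : realType) (P : set nat).

(** The conversion of a sequence of tests into a distance: membership of the
    value in a ball of radius [1 / n.+1] only depends on the first [n.+1]
    tests ([inv_first_lt]). *)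
Definition inv_first : R :=
  if pselect (exists n, `[< P n >]) is left e then (ex_minn e).+1%:R^-1 else 0.

Lemma inv_first_ge0 : 0 <= inv_first.
Proof. by rewrite /inv_first; case: pselect. Qed.

Lemma inv_first_eq0 : inv_first = 0 <-> forall n, ~ P n.
Proof.
rewrite /inv_first; case: pselect => [e|ne]; split => //.
- by move=> /eqP; rewrite invr_eq0 pnatr_eq0.
- by have [n /asboolP s] := e; move=> /(_ n).
- by move=> _ n s; apply: ne; exists n; apply/asboolP.
Qed.

Lemma inv_first_lt n :
  inv_first < n.+1%:R^-1 <-> forall i, (i <= n)%N -> ~ P i.
Proof.
rewrite /inv_first; case: pselect => [e|ne]; last first.
  split=> [_ i _ s|_]; last by rewrite invr_gt0 ltr0Sn.
  by apply: ne; exists i; apply/asboolP.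
case: ex_minnP => m /asboolP Pm minm.
rewrite ltf_pV2 ?posrE ?ltr0Sn// ltr_nat ltnS; split=> [nm i le_in Pi|h].
- by have := minm i (asboolT Pi); rewrite leqNgt (leq_ltn_trans le_in nm).
- by rewrite ltnNge; apply/negP => /h; exact.
Qed.

End InvFirst.

Section Shrinking.
Variables (R : realType) (X : topologicalType) (F U : nat -> set X).

Let separates n x y := F n x /\ ~ U n y \/ F n y /\ ~ U n x.

(** The balls of the distance built from [separates] are open neighbourhoods
    of their centres: a ball is a finite intersection of the sets of points
    that one stage does not separate from the centre, and such a set is cut
    out by [U n] when the centre is in [F n], and by the complement of [F n]
    when the centre is outside [U n]. The triangle inequality may fail,
    because being separated at no early stage is not a transitive relation. *)
Lemma symmetrizable_shrinking :
  (forall n, closed (F n)) -> (forall n, open (U n)) ->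
  (forall n, F n `<=` U n) ->
  (forall V x, open V -> V x -> exists n, F n x /\ U n `<=` V) ->
  accessible_space X -> symmetrizable R X.
Proof.
move=> clF opU FU fine T1.
pose d x y := inv_first R (fun n => separates n x y).
have ball_open n x : open (dball d x n.+1%:R^-1).
  have -> : dball d x n.+1%:R^-1 = \bigcap_(i < n.+1) ~` separates i x.
    apply/seteqP; split=> y.
      by move=> /inv_first_lt h i; rewrite /= ltnS; exact: h.
    by move=> h; apply/inv_first_lt => i; rewrite -ltnS; exact: h.
  rewrite bigcap_mkord; apply: big_ind; first exact: openT.
    by move=> A B; exact: openI.
  move=> i _.
  have -> : ~` separates i x =
      (if `[< F i x >] then U i else setT) `&`
      (if `[< U i x >] then setT else ~` F i).
    apply/seteqP; split => y /=; rewrite /separates.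
    - move=> h; split; case: asboolP => // p; last by move=> q; apply: h; right.
      by apply: contrapT => q; apply: h; left.
    - move=> -[+ +] [] [p q].
        by rewrite asboolT.
      by move=> _; rewrite asboolF.
  apply: openI; case: ifP => _ //; first [exact: openT|exact: closed_openC].
have ball_sub V x : open V -> V x -> exists n, dball d x n.+1%:R^-1 `<=` V.
  move=> oV Vx; have [n [Fx UV]] := fine _ _ oV Vx; exists n => y.
  move=> /inv_first_lt/(_ n (leqnn n)) h; apply: UV.
  by apply: contrapT => Uy; apply: h; left.
exists d.
  split; first by move=> x y; exact: inv_first_ge0.
  - move=> x y; split=> [d0|->].
      apply: contrapT => /eqP/T1[V [oV /set_mem Vx /set_mem]]; apply.
      have [n] := ball_sub _ _ oV Vx; apply.
      by rewrite /dball /= d0 invr_gt0 ltr0Sn.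
    by apply/inv_first_eq0 => n [] [/FU].
  - move=> x y; congr inv_first; apply/funext => n; apply/propext.
    by split=> -[] h; [right | left | right | left].
move=> V; split=> [oV x Vx|h].
  have [n s] := ball_sub _ _ oV Vx.
  by exists n.+1%:R^-1%R => //; rewrite invr_gt0 ltr0Sn.
rewrite openE => x /h[e e0 s].
have [k] := ltr_add_invr e0; rewrite add0r => ke.
rewrite /interior nbhsE; exists (dball d x k.+1%:R^-1).
  split; first exact: ball_open.
  by apply/inv_first_lt => i _ [] [/FU].
by move=> y dy; apply: s; exact: lt_trans dy ke.
Qed.

End Shrinking.

(** * The topology of a continuous metric *)

(** A synonym of [X] that carries the topology generated by [rho], so that [X]
    can keep the topology it already has. *)
Definition dist_space (R : realType) (X : choiceType) (rho : X -> X -> R) : Type :=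
  X.

Section DistSpace.
Variables (R : realType) (X : choiceType) (rho : X -> X -> R).

Definition dist_open (U : set X) :=
  forall x, U x -> exists2 e : R, (0 < e)%R & dball rho x e `<=` U.

Let dist_openT : dist_open setT.
Proof. by move=> x _; exists 1%R. Qed.

Let dist_openI : setI_closed dist_open.
Proof.
move=> A B oA oB x [/oA[e e0 eA] /oB[f f0 fB]].
exists (Num.min e f); first by rewrite lt_min e0 f0.
by move=> y; rewrite /dball /= lt_min => /andP[/eA + /fB].
Qed.

Let dist_open_bigU (I : Type) (f : I -> set X) :
  (forall i, dist_open (f i)) -> dist_open (\bigcup_i f i).
Proof.
move=> of_ x [i _ /of_[e e0 ef]]; exists e => // y /ef; by exists i.
Qed.

HB.instance Definition _ := Choice.on (dist_space rho).
HB.instance Definition _ := isOpenTopological.Build (dist_space rho)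
  dist_openT dist_openI dist_open_bigU.

Lemma dist_space_generated : @generates_topology R (dist_space rho) rho.
Proof. by []. Qed.

End DistSpace.

Section ContinuousMetric.
Variables (R : realType) (X : topologicalType) (rho : X -> X -> R).
Hypotheses (rho_metric : is_metric rho)
  (rho_cont : continuous (fun p : X * X => rho p.1 p.2)).

Lemma dball_center x e : (0 < e)%R -> dball rho x e x.
Proof.
by have [[_ r0 _] _] := rho_metric; rewrite /dball /= (r0 x x).2.
Qed.

Lemma continuous_metric_dball_open x e : open (dball rho x e).
Proof.
apply: (@open_comp _ _ (rho x) [set z | (z < e)%R]); last exact: open_lt.
move=> y _; apply: (@continuous_comp _ _ _ (fun z => (x, z))
  (fun p => rho p.1 p.2)); last exact: rho_cont.
by apply: cvg_pair => //; exact: cvg_cst.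
Qed.

Lemma continuous_metric_accessible : accessible_space X.
Proof.
have [[r_ge0 r0 _] _] := rho_metric.
move=> x y /eqP xy; exists (dball rho x (rho x y)); split.
- exact: continuous_metric_dball_open.
- apply/mem_set/dball_center; rewrite lt_def r_ge0 andbT.
  by apply/eqP => /r0.
- by apply/mem_set; rewrite /dball /= ltxx.
Qed.

Lemma dist_space_open (U : set X) : @open (dist_space rho) U -> open U.
Proof.
move=> oU; rewrite openE => x /oU[e e0 eU].
rewrite /interior nbhsE; exists (dball rho x e) => //.
split; [exact: continuous_metric_dball_open | exact: dball_center].
Qed.

(** A G_delta stays one in a finer topology. *)
Lemma dist_space_Q_space : Q_space (dist_space rho) -> Q_space X.
Proof.
move=> QY A; have [G oG AG] := QY A.
by exists G => // i; exact: dist_space_open.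
Qed.

Lemma dist_space_dball_open x e :
  @open (dist_space rho) (dball rho x e).
Proof.
have [_ tri] := rho_metric.
move=> y xy; exists (e - rho x y)%R; first by rewrite subr_gt0.
move=> z; rewrite /dball /= ltrBrDl; apply: le_lt_trans; exact: tri.
Qed.

(** Choosing a point in each member of a countable base of [X] gives a dense
    set, and the balls of radius [1 / n.+1] around its points form a base of
    the metric topology. *)
Lemma dist_space_second_countable :
  @second_countable X -> @second_countable (dist_space rho).
Proof.
have [[_ _ sym] tri] := rho_metric.
have [[x0 _]|X0] := pselect ([set: X] !=set0); last first.
  by exists set0; [exact: countable0 | split=> // x; case: X0; exists x].
move=> [B cB [oB basisB]].
pose c (b : set X) := xget x0 b.
pose f (p : set X * nat) : set (dist_space rho) :=
  dball rho (c p.1) p.2.+1%:R^-1.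
exists (f @` (B `*` setT)).
  apply: card_le_trans (card_image_le _ _) _.
  by apply: countableX => //; exact: countableP.
split; first by move=> _ [p _ <-]; exact: dist_space_dball_open.
move=> y A; rewrite nbhsE => -[V [oV Vy] VA].
have [e e0 eV] := oV _ Vy.
(* Half of [e] for the step from [y] to the centre [c b] of the basic ball, and
   half for the step from [c b] to any other point of that ball. *)
have [k] := ltr_add_invr (divr_gt0 e0 (ltr0Sn R 1)); rewrite add0r => ke.
have : nbhs (y : X) (dball rho y k.+1%:R^-1).
  apply: open_nbhs_nbhs; split; first exact: continuous_metric_dball_open.
  by apply: dball_center; rewrite invr_gt0 ltr0Sn.
move=> /basisB[b [Bb by_] bsub].
have yc : dball rho y k.+1%:R^-1 (c b) by apply: bsub; exact: (@xgetI X x0 b y).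
exists (f (b, k)).
  by split; [exists (b, k) | rewrite /f /dball /= sym].
move=> z cz; apply/VA/eV; rewrite /dball /=.
apply: le_lt_trans (tri y (c b) z) _.
by rewrite (splitr e); apply: ltrD; [exact: lt_trans ke | exact: lt_trans cz ke].
Qed.

End ContinuousMetric.

(** * Q-spaces *)

(** Otherwise [K] would embed in [Y] by minimality, and Cantor-Bernstein would
    make the strict inequality of cardinals an equality. *)
Lemma lt_q0_Q_space (R : realType) (K : Type) (Y : topologicalType) :
  is_q0 R K -> @second_countable Y -> metrizable R Y ->
  card_lt [set: Y] [set: K] -> Q_space Y.
Proof.
move=> [_ minK] scY mY [leYK neYK]; apply: contrapT => nQ; apply: neYK.
by apply: Cantor_Bernstein => //; exact: minK.
Qed.

Lemma Q_space_Fsigma (Y : topologicalType) : Q_space Y -> forall A : set Y,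
  exists F : nat -> set Y, (forall m, closed (F m)) /\ A = \bigcup_m F m.
Proof.
move=> QY A; have [G oG AG] := QY (~` A); exists (fun m => ~` G m); split.
  by move=> m; exact: open_closedC.
by rewrite -setC_bigcap -AG setCK.
Qed.

(** Each member of a countable base is an F_sigma, and the pairs formed by a
    basic open set and one of the closed sets exhausting it make up the family
    that [symmetrizable_shrinking] asks for. *)
Lemma symmetrizable_Q_space (R : realType) (X : topologicalType) :
  @second_countable X -> accessible_space X -> Q_space X -> symmetrizable R X.
Proof.
move=> [B cB [oB basisB]] T1 QX.
have [G GP] := choice (Q_space_Fsigma QX).
have /pcard_surjP[g gB] := cB.
pose I n : nat * nat := odflt (0%N, 0%N) (unpickle n).
(* [g] covers [B] but may also take values that are not open; the interior
   repairs these and fixes the members of [B]. *)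
pose U k := interior (g k).
apply: (@symmetrizable_shrinking R X
  (fun n => G (U (I n).1) (I n).2) (fun n => U (I n).1)) => //.
- by move=> n; exact: (GP _).1.
- by move=> n; exact: open_interior.
- by move=> n x Fx; rewrite (GP (U (I n).1)).2; exists (I n).2.
- move=> V x oV Vx.
  have [b [Bb bx] bV] := basisB x V (open_nbhs_nbhs (conj oV Vx)).
  have [k _ gk] := gB _ Bb.
  have Ub : U k = b by rewrite /U gk; apply/interior_id/oB.
  have [m _ Gx] : (\bigcup_m G b m) x by rewrite -(GP b).2.
  by exists (pickle (k, m)); rewrite /I pickleK /= Ub.
Qed.

Theorem proposition7 (R : realType) (q0 : Type) (hq0 : is_q0 R q0)
    (X : topologicalType) (hsc : @second_countable X)
    (hsub : submetrizable R X) (hcard : card_lt [set: X] [set: q0]) :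
  symmetrizable R X.
Proof.
have [rho rho_metric rho_cont] := hsub.
have QX : Q_space X.
  apply: (dist_space_Q_space rho_metric rho_cont).
  apply: (@lt_q0_Q_space R q0 (dist_space rho) hq0) => //.
    exact: dist_space_second_countable.
  by exists rho => //; exact: dist_space_generated.
apply: symmetrizable_Q_space QX => //.
exact: continuous_metric_accessible rho_metric rho_cont.
Qed.
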